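(* The following hold: (1) If $n\ge 3$, there exists an entire spacelike function $u:\mathbb R^n\to\mathbb R$ such that $\mathcal H_1[u]>0$ on $\mathbb R^n$ and $\sup_{\mathbb R^n}u<+\infty$. (2) If $n\ge5$, there exists an entire spacelike function $u:\mathbb R^n\to\mathbb R$ which is admissible and bounded. (3) If $n\ge 6$, there exist a constant $c>0$ and an entire admissible function $u:\mathbb R^n\to\mathbb R$ such that $|x_1|\le u(x)\le\sqrt{x_1^2+c}$ for all $x=(x_1,x')\in\mathbb R\times\mathbb R^{n-1}=\mathbb R^n$.
   Context: A $C^2$ function $u:\mathbb R^n\to\mathbb R$ is spacelike if $|Du|<1$ everywhere. The shape operator of its graph in Minkowski space $\mathbb R^{n,1}$ (metric $dx_1^2+\dots+dx_n^2-dx_{n+1}^2$), with respect to the future unit normal, is $h^i_j=\frac{1}{\sqrt{1-|Du|^2}}\sum_k\left(\delta_{ik}+\frac{\partial_iu\,\partial_ku}{1-|Du|^2}\right)\partial^2_{kj}u$; its eigenvalues are the principal curvatures $\lambda_1,\dots,\lambda_n$, and $\mathcal H_k[u]=\frac{k!(n-k)!}{n!}\sigma_k(\lambda_1,\dots,\lambda_n)$, with $\sigma_k$ the $k$-th elementary symmetric polynomial. $u\in C^2(\mathbb R^n)$ is admissible if $|Du|<1$, $\mathcal H_1[u]>0$ and $\mathcal H_2[u]>0$ on $\mathbb R^n$. *)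

(* Defs.v *)
From mathcomp Require Import all_boot all_order all_algebra.
From mathcomp Require Import all_classical all_reals all_analysis.

Set Implicit Arguments.
Unset Strict Implicit.
Unset Printing Implicit Defensive.

Import Order.TTheory GRing.Theory Num.Theory.
Import numFieldNormedType.Exports.

Local Open Scope classical_set_scope.
Local Open Scope ring_scope.

Section SpacelikeGraphs.
Variables (R : realType) (n : nat).
Implicit Types (u : 'rV[R]_n -> R) (x : 'rV[R]_n) (i j k : 'I_n).

Definition partial i u : 'rV[R]_n -> R := 'D_(delta_mx 0 i) u.

(* 'D_v is a total operator, so derivability is required separately. *)
Definition has_partial i u := forall x, derivable u x (delta_mx 0 i).

Definition C2 u :=
  [/\ continuous u,
      forall i, has_partial i u /\ continuous (partial i u) &
      forall i j, has_partial i (partial j u) /\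
                  continuous (partial i (partial j u))].

(* The Euclidean norm |Du(x)|; the library norm on 'rV[R]_n is the sup norm. *)
Definition norm_grad u x : R := Num.sqrt (\sum_i (partial i u x) ^+ 2).

Definition spacelike u := C2 u /\ forall x, norm_grad u x < 1.

Definition shape_operator u x : 'M[R]_n :=
  \matrix_(i, j)
    ((Num.sqrt (1 - norm_grad u x ^+ 2))^-1 *
     \sum_k ((i == k)%:R +
             partial i u x * partial k u x / (1 - norm_grad u x ^+ 2)) *
            partial k (partial j u) x).

(* The eigenvalues of the shape operator listed with algebraic multiplicity, in
   some order.  They are all real when u is spacelike, the operator being
   self-adjoint for the induced metric; otherwise the value 0 is a dummy. *)
Definition principal_curvatures u x : 'rV[R]_n :=
  xget 0 [set l : 'rV[R]_n |
    char_poly (shape_operator u x) = \prod_i ('X - (l 0 i)%:P)].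

Definition sigma (k : nat) (l : 'rV[R]_n) : R :=
  \sum_(A : {set 'I_n} | #|A| == k) \prod_(i in A) l 0 i.

Definition mean_curvature (k : nat) u x : R :=
  (k`! * (n - k)`!)%:R / n`!%:R * sigma k (principal_curvatures u x).

Definition admissible u :=
  [/\ spacelike u,
      forall x, 0 < mean_curvature 1 u x &
      forall x, 0 < mean_curvature 2 u x].

End SpacelikeGraphs.

(* Main.v *)
Require Import Defs.
From mathcomp Require Import all_boot all_order all_algebra.
From mathcomp Require Import all_classical all_reals all_analysis.
From mathcomp Require Import ring lra.
Import Order.TTheory GRing.Theory Num.Theory.
Import numFieldNormedType.Exports.
Local Open Scope classical_set_scope.
Local Open Scope ring_scope.

Set Implicit Arguments.
Unset Strict Implicit.
Unset Printing Implicit Defensive.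

(** For a set [A] of coordinates put [s = \sum_(i in A) x_i^2] and
    [u = sqrt (\sum_(i notin A) x_i^2 + P s)] with [P s = 2 - (1 + s)^(-1/8)].
    Differentiating [u^2] gives [u D^2u = E - Du Du^T], where [E] is diagonal
    plus the rank one matrix [2 P'' y y^T], [y] being the part of [x] in [A];
    since [E Du - Du] is a multiple of [y], the shape operator is again diagonal
    plus a rank one matrix [z y^T].  Hence, up to a common positive factor, the
    principal curvatures are [1] (once for each [i notin A]), [a = P' s]
    ([#|A| - 1] times) and [a + B], where the exponent [1/8] is small enough
    for [B > - 5/2 a].  So [H_1 > 0] as soon as [#|A| >= 3] and [H_2 > 0] as soon
    as [#|A| >= 5].  Taking for [A] all coordinates gives (1) and (2), and taking
    all but the first gives (3). *)

(** * Symmetric functions of the eigenvalues, and characteristic polynomials *)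

(** When the product is expanded, the set [A] of factors from which the linear term is taken
    contributes only in degree [#|A|]. *)
Lemma sigma_coef (R : realType) (n k : nat) (l : 'rV[R]_n) :
  sigma k l = (\prod_i (l 0 i *: 'X + 1))`_k.
Proof.
rewrite bigA_distr coef_sum /sigma [RHS](bigID (fun A : {set 'I_n} => #|A| == k)) /=.
rewrite [X in _ = _ + X]big1 ?addr0; last first.
  move=> A Ak; rewrite -big_mkcondr /= big_mkcond /=.
  have -> : \prod_i (if i \in A then l 0 i *: 'X else 1) =
            (\prod_(i in A) l 0 i) *: 'X^#|A| :> {poly R}.
    by rewrite -big_mkcond /= scaler_prod prodr_const.
  by rewrite coefZ coefXn eq_sym (negPf Ak) mulr0.
apply: eq_bigr => A /eqP Ak.
rewrite -big_mkcond /= scaler_prod prodr_const Ak.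
by rewrite coefZ coefXn eqxx mulr1.
Qed.

(** Unique factorization determines the roots up to order, and [sigma] is symmetric. Hence any
    explicit list of eigenvalues may replace the one chosen in [principal_curvatures]. *)
Lemma sigma_char_poly (R : realType) (n k : nat) (l m : 'rV[R]_n) :
  \prod_i ('X - (l 0 i)%:P) = \prod_i ('X - (m 0 i)%:P) ->
  sigma k l = sigma k m.
Proof.
move=> lm; rewrite !sigma_coef; congr ((polyseq _)`_k).
have E (h : R -> {poly R}) (r : 'rV[R]_n) :
    \prod_i h (r 0 i) = \prod_(a <- [seq r 0 i | i : 'I_n]) h a.
  by rewrite big_image.
rewrite (E (fun a => a *: 'X + 1)) [in RHS](E (fun a => a *: 'X + 1)).
by apply: perm_big; apply: prod_XsubC_eq; rewrite -!(E (fun a => 'X - a%:P)).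
Qed.

(** Newton's identities in degrees 1 and 2, stated for a sequence so that induction applies. They
    reduce both mean curvatures to power sums. *)
Lemma coef_prod_linear (R : comNzRingType) (s : seq R) :
  let p : {poly R} := \prod_(a <- s) (a *: 'X + 1) in
  [/\ p`_0 = 1, p`_1 = \sum_(a <- s) a &
      2 * p`_2 = (\sum_(a <- s) a) ^+ 2 - \sum_(a <- s) a ^+ 2].
Proof.
elim: s => [|a s] /=.
  by rewrite !big_nil !coef1 /=; split; rewrite // mulr0 expr0n subr0.
rewrite !big_cons; set p := \prod_(_ <- s) _ => -[p0 p1 p2].
rewrite mulrDl mul1r -scalerAl !coefD !coefZ !coefXM /= p0 p1.
split; rewrite ?mulr0 ?add0r ?mulr1 //.
by rewrite mulrDr p2; ring.
Qed.

Lemma sigma1E (R : realType) (n : nat) (l : 'rV[R]_n) :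
  sigma 1 l = \sum_i l 0 i.
Proof.
rewrite sigma_coef.
have [_] := coef_prod_linear [seq l 0 i | i : 'I_n].
by rewrite !big_image /= => ->.
Qed.

Lemma sigma2E (R : realType) (n : nat) (l : 'rV[R]_n) :
  2 * sigma 2 l = (\sum_i l 0 i) ^+ 2 - \sum_i l 0 i ^+ 2.
Proof.
rewrite sigma_coef.
have [_ _] := coef_prod_linear [seq l 0 i | i : 'I_n].
by rewrite !big_image /= => ->.
Qed.

Lemma det_diag_rank1 (R : comNzRingType) (n : nat) (D : 'rV[R]_n)
    (z : 'cV[R]_n) (y : 'rV[R]_n) (t : R) :
  y *m diag_mx D = t *: y ->
  t * \det (diag_mx D - z *m y) = (t - (y *m z) 0 0) * \prod_i D 0 i.
Proof.
(* Factor [[1, y], [z, D]] in two ways; [t] is kept as a factor because [D] need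
   not be invertible. *)
move=> yD.
have E1 : block_mx (1%:M : 'M[R]_1) y z (diag_mx D) =
    block_mx 1%:M 0 z 1%:M *m block_mx 1%:M y 0 (diag_mx D - z *m y).
  rewrite mulmx_block !mul1mx !mul0mx !mulmx1 !addr0.
  by rewrite addrC subrK.
have E2 : block_mx (t%:M : 'M[R]_1) (- y) 0 1%:M *m
    block_mx (1%:M : 'M[R]_1) y z (diag_mx D) =
    block_mx (t%:M - y *m z) 0 z (diag_mx D).
  rewrite mulmx_block !mul1mx !mul0mx !mulmx1 !mulNmx yD mul_scalar_mx.
  by rewrite subrr !add0r.
have := congr1 determinant E2.
rewrite det_mulmx E1 det_mulmx !det_ublock !det_lblock !det1 !mul1r mulr1.
by rewrite det_diag !det_mx11 !mxE eqxx mulr1n.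
Qed.

(** The hypothesis says that [d] takes the value [d 0 i0] on the support of [y], so [y] is a left
    eigenvector of the diagonal part and only one eigenvalue moves. The factor [t] of the
    determinant identity is a nonzero polynomial and can be cancelled. *)
Lemma char_poly_diag_rank1 (F : fieldType) (n : nat) (d : 'rV[F]_n)
    (z : 'cV[F]_n) (y : 'rV[F]_n) (i0 : 'I_n) :
  (forall i, y 0 i * (d 0 i - d 0 i0) = 0) ->
  char_poly (diag_mx d + z *m y) =
  \prod_i ('X - (if i == i0 then d 0 i0 + (y *m z) 0 0 else d 0 i)%:P).
Proof.
move=> yd; pose t : {poly F} := 'X - (d 0 i0)%:P.
pose D : 'rV[{poly F}]_n := \row_i ('X - (d 0 i)%:P).
pose Z := map_mx polyC z; pose Y := map_mx polyC y.
have t0 : t != 0 by rewrite polyXsubC_eq0.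
have YD : Y *m diag_mx D = t *: Y.
  apply/rowP => i; rewrite mul_mx_diag !mxE /t.
  have yd0 : (y 0 i)%:P * ((d 0 i)%:P - (d 0 i0)%:P) = 0 :> {poly F}.
    by rewrite -polyCB -polyCM yd.
  by apply/eqP; rewrite -subr_eq0 -oppr_eq0 -yd0; apply/eqP; ring.
apply: (mulfI t0); rewrite /char_poly.
have -> : char_poly_mx (diag_mx d + z *m y) = diag_mx D - Z *m Y.
  rewrite /char_poly_mx map_mxD map_mxM opprD addrA; congr (_ - _).
  apply/matrixP => i j; rewrite !mxE.
  by case: eqVneq => [->|_]; rewrite ?mulr1n // !mulr0n subr0.
rewrite (det_diag_rank1 _ YD) (bigD1 i0) //= [in RHS](bigD1 i0) //=.
have YZ : (Y *m Z) 0 0 = ((y *m z) 0 0)%:P by rewrite -map_mxM mxE.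
rewrite eqxx YZ [RHS]mulrCA; congr (_ * (_ * _)); last first.
  by apply: eq_bigr => i /negPf ->; rewrite mxE.
  by rewrite mxE.
by rewrite /t polyCD opprD addrA.
Qed.

Lemma mean_curvature_gt0 (R : realType) (n k : nat) (u : 'rV[R]_n -> R)
    (x l : 'rV[R]_n) :
  char_poly (shape_operator u x) = \prod_i ('X - (l 0 i)%:P) ->
  0 < sigma k l -> 0 < mean_curvature k u x.
Proof.
move=> charE sigma_gt0; rewrite /mean_curvature.
rewrite mulr_gt0 ?divr_gt0 ?ltr0n ?muln_gt0 ?fact_gt0 //.
rewrite (@sigma_char_poly _ _ k (principal_curvatures u x) l) //.
(* The default value of [xget] cannot occur, since [l] is a factorization. *)
rewrite /principal_curvatures; case: xgetP => [m _ /= <- //|/(_ l) /=].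
by rewrite charE.
Qed.

(** * Directional derivatives *)

(** A directional derivative sees only the restriction to a line, so the one-variable chain rule can
    be used without total differentiability. *)
Lemma is_derive_line (R : realType) (V : normedModType R) (f : V -> R)
    (x v : V) (df : R) :
  is_derive x v f df <-> is_derive (0 : R) 1 (fun t => f (t *: v + x)) df.
Proof.
have E : 'D_v f x = 'D_1 (fun t : R => f (t *: v + x)) 0.
  rewrite /derive; set k1 := fun h => h^-1 *: _; set k2 := fun h => h^-1 *: _.
  suff -> : k1 = k2 by [].
  by apply/funext => h; rewrite /k1 /k2 /= addr0 scale0r add0r [_%:A]mulr1.
have [D1 D2] := derivable1P f x v.
by split=> -[Df <-]; apply: DeriveDef; rewrite ?E //; [exact: D1|exact: D2].
Qed.

Lemma is_derive_comp_real (R : realType) (V : normedModType R) (f : R -> R)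
    (g : V -> R) (x v : V) (df dg : R) :
  is_derive (g x) 1 f df -> is_derive x v g dg ->
  is_derive x v (fun y => f (g y)) (df * dg).
Proof.
move=> Df /is_derive_line Dg; apply/is_derive_line.
by apply: is_derive1_comp => //; rewrite scale0r add0r.
Qed.

Lemma is_derive_coord (R : realType) (n : nat) (i j : 'I_n) (x : 'rV[R]_n) :
  is_derive x (delta_mx 0 j) (fun y : 'rV[R]_n => y 0 i) (i == j)%:R.
Proof.
apply/is_derive_line.
have -> : (fun t : R => (t *: delta_mx 0 j + x) 0 i) =
    (id * cst (i == j)%:R + cst (x 0 i)).
  by apply/funext => t; rewrite !mxE.
apply: is_derive_eq.
by rewrite scaler0 add0r addr0 [_%:A]mulr1.
Qed.

Definition weighted_sq {R : realType} {n : nat} (w : 'I_n -> R) (x : 'rV[R]_n) : R :=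
  \sum_i w i * x 0 i ^+ 2.

Lemma is_derive_weighted_sq (R : realType) (n : nat) (w : 'I_n -> R) (j : 'I_n)
    (x : 'rV[R]_n) :
  is_derive x (delta_mx 0 j) (weighted_sq w) (2 * w j * x 0 j).
Proof.
have -> : weighted_sq w = \sum_i (cst (w i) * ((fun y : 'rV[R]_n => y 0 i) ^+ 2)).
  by apply/funext => y; rewrite fct_sumE.
have Di i : is_derive x (delta_mx 0 j)
    (cst (w i) * ((fun y : 'rV[R]_n => y 0 i) ^+ 2)) 
    (w i * (2 * x 0 i * (i == j)%:R)).
  have Dc := is_derive_coord i j x.
  apply: is_derive_eq => /=.
  by rewrite scaler0 addr0 expr1 /GRing.scale /=.
apply: is_derive_eq.
rewrite (bigD1 j) //= eqxx big1 => [|i /negPf ->]; last by rewrite !mulr0.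
by rewrite addr0 mulr1; ring.
Qed.

Lemma continuous_weighted_sq (R : realType) (n : nat) (w : 'I_n -> R) :
  continuous (@weighted_sq R n w).
Proof.
have -> : weighted_sq w = \sum_i (cst (w i) * ((fun y : 'rV[R]_n => y 0 i) ^+ 2)).
  by apply/funext => y; rewrite fct_sumE.
move=> x; elim/big_ind: _ => [|f g|i _]; [exact: cst_continuous|exact: continuousD|].
apply: continuousM; first exact: cst_continuous.
by rewrite expr2; apply: continuousM; apply: coord_continuous.
Qed.

(** * The one-variable function behind the graph *)

(** This is the power $(1+s)^{-1/8}$. *)
Definition decay {R : realType} (s : R) : R := expR (- 8^-1 * ln (1 + s)).

(* The first and second derivatives of [2 - decay s]. *)
Definition slope {R : realType} (s : R) : R := 8^-1 * decay s * (1 + s)^-1.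

Definition bend {R : realType} (s : R) : R :=
  - (9 / 64) * decay s * (1 + s)^-1 ^+ 2.

Lemma is_derive_decay (R : realType) (s : R) : 0 <= s ->
  is_derive s 1 decay (- slope s).
Proof.
move=> s0; have s1 : 0 < 1 + s by lra.
have D1 : is_derive s 1 (fun t : R => 1 + t) 1.
  have -> : (fun t : R => 1 + t) = cst 1 + id by [].
  by apply: is_derive_eq; rewrite add0r.
have D2 := is_derive_comp_real (is_derive1_ln s1) D1.
have D3 : is_derive s 1 (fun t : R => - 8^-1 * ln (1 + t)) (- 8^-1 * (1 + s)^-1).
  have -> : (fun t : R => - 8^-1 * ln (1 + t)) = cst (- 8^-1) * (fun t => ln (1 + t)) by [].
  by apply: is_derive_eq; rewrite scaler0 addr0 mulr1.
have D4 := is_derive_comp_real (is_derive_expR _) D3.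
apply: (is_derive_eq D4).
by rewrite /slope /decay; ring.
Qed.

Lemma is_derive_slope (R : realType) (s : R) : 0 <= s ->
  is_derive s 1 slope (bend s).
Proof.
move=> s0; have s1 : 1 + s != 0 by apply: lt0r_neq0; lra.
have D1 : is_derive s 1 (fun t : R => 1 + t) 1.
  have -> : (fun t : R => 1 + t) = cst 1 + id by [].
  by apply: is_derive_eq; rewrite add0r.
have D2 := is_deriveV s1 D1.
have D3 := is_derive_decay s0.
have -> : slope = cst 8^-1 * decay * (fun t : R => (1 + t)^-1) by [].
apply: is_derive_eq.
rewrite /GRing.scale /= !fctE /bend /slope; field.
exact: s1.
Qed.

Lemma continuous_decay (R : realType) (s : R) : 0 <= s ->
  {for s, continuous decay}.
Proof.
move=> /is_derive_decay[+ _]. 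
by move=> /derivable1_diffP/differentiable_continuous.
Qed.

Lemma decay_gt0 (R : realType) (s : R) : 0 < decay s.
Proof. exact: expR_gt0. Qed.

Lemma decay_le1 (R : realType) (s : R) : 0 <= s -> decay s <= 1.
Proof.
move=> s0; rewrite /decay -[leRHS]expR0 ler_expR.
have : 0 <= ln (1 + s) by apply: ln_ge0; lra.
lra.
Qed.

(** * The graph function and its derivatives up to order two *)

Definition chi {R : realType} {n : nat} (A : {set 'I_n}) (i : 'I_n) : R :=
  (i \in A)%:R.

Definition profile {R : realType} {n : nat} (A : {set 'I_n}) (x : 'rV[R]_n) : R :=
  Num.sqrt (weighted_sq (chi (~: A)) x + (2 - decay (weighted_sq (chi A) x))).

(** Half the gradient of $u^2$ has the coordinates [weight A x i * x 0 i]; the weights also form the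
    diagonal part of [E]. *)
Definition weight {R : realType} {n : nat} (A : {set 'I_n}) (x : 'rV[R]_n)
    (i : 'I_n) : R := chi (~: A) i + chi A i * slope (weighted_sq (chi A) x).

Lemma weighted_sq_ge0 (R : realType) (n : nat) (A : {set 'I_n}) (x : 'rV[R]_n) :
  0 <= weighted_sq (chi A) x.
Proof. by apply: sumr_ge0 => i _; rewrite mulr_ge0 ?sqr_ge0 ?ler0n. Qed.

Lemma radicand_gt0 (R : realType) (n : nat) (A : {set 'I_n}) (x : 'rV[R]_n) :
  0 < weighted_sq (chi (~: A)) x + (2 - decay (weighted_sq (chi A) x)).
Proof.
have := weighted_sq_ge0 (~: A) x; have := decay_le1 (weighted_sq_ge0 A x); lra.
Qed.

Lemma profile_gt0 (R : realType) (n : nat) (A : {set 'I_n}) (x : 'rV[R]_n) :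
  0 < profile A x.
Proof. by rewrite sqrtr_gt0 radicand_gt0. Qed.

Definition profile_grad {R : realType} {n : nat} (A : {set 'I_n}) (i : 'I_n)
    (x : 'rV[R]_n) : R := weight A x i * x 0 i / profile A x.

Definition profile_hess {R : realType} {n : nat} (A : {set 'I_n}) (i j : 'I_n)
    (x : 'rV[R]_n) : R :=
  ((i == j)%:R * weight A x i
   + 2 * bend (weighted_sq (chi A) x) * (chi A i * x 0 i) * (chi A j * x 0 j)
   - profile_grad A i x * profile_grad A j x) / profile A x.

Lemma is_derive_profile (R : realType) (n : nat) (A : {set 'I_n}) (i : 'I_n)
    (x : 'rV[R]_n) :
  is_derive x (delta_mx 0 i) (profile A) (profile_grad A i x).
Proof.
have D1 := is_derive_comp_real
  (is_derive_decay (weighted_sq_ge0 A x)) (is_derive_weighted_sq (chi A) i x).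
have D2 := is_derive_weighted_sq (chi (~: A)) i x.
have D3 : is_derive x (delta_mx 0 i)
   (fun y => weighted_sq (chi (~: A)) y + (2 - decay (weighted_sq (chi A) y)))
   (2 * weight A x i * x 0 i).
  have -> : (fun y => weighted_sq (chi (~: A)) y
                      + (2 - decay (weighted_sq (chi A) y))) =
    weighted_sq (chi (~: A))
    + (cst 2 - (fun y => decay (weighted_sq (chi A) y))) by [].
  have Dc := is_derive_cst (2 : R) x (delta_mx 0 i).
  have D := is_deriveD D2 (is_deriveB Dc D1).
  have <- : 2 * chi (~: A) i * x 0 i
      + (0 - - slope (weighted_sq (chi A) x) * (2 * chi A i * x 0 i)) =
    2 * weight A x i * x 0 i by rewrite /weight; ring.
  exact: D.
apply: is_derive_eq.
  exact: (@is_derive_comp_real _ _ _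
    (fun y : 'rV[R]_n => weighted_sq (chi (~: A)) y + (2 - decay (weighted_sq (chi A) y)))
    _ _ _ _ (is_derive1_sqrt (radicand_gt0 A x)) D3).
have := lt0r_neq0 (profile_gt0 A x).
by rewrite /profile_grad /profile => ?; field.
Qed.

Lemma is_derive_profile_grad (R : realType) (n : nat) (A : {set 'I_n})
    (i j : 'I_n) (x : 'rV[R]_n) :
  is_derive x (delta_mx 0 i) (profile_grad A j) (profile_hess A i j x).
Proof.
have u0 := lt0r_neq0 (profile_gt0 A x).
have D1 := is_derive_comp_real
  (is_derive_slope (weighted_sq_ge0 A x)) (is_derive_weighted_sq (chi A) i x).
have D2 : is_derive x (delta_mx 0 i) (fun y => (profile A y)^-1)
    (- profile A x ^- 2 * profile_grad A i x).
  have Du := is_derive_profile A i x.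
  by apply: DeriveDef; [apply: derivableV|rewrite deriveV // derive_val].
have D3 := is_derive_coord j i x.
have -> : profile_grad A j =
    (cst (chi (~: A) j) + cst (chi A j) * (fun y => slope (weighted_sq (chi A) y)))
    * (fun y : 'rV[R]_n => y 0 j) * (fun y => (profile A y)^-1) by [].
apply: is_derive_eq.
rewrite /profile_hess /profile_grad /GRing.scale /= [j == i]eq_sym.
have -> : (i == j)%:R * weight A x i = (i == j)%:R * weight A x j.
  by case: eqVneq => [->|_] //; rewrite !mul0r.
rewrite /weight !fctE.
by field.
Qed.

Lemma profile_C2 (R : realType) (n : nat) (A : {set 'I_n}) :
  [/\ C2 (@profile R n A),
      forall i, partial i (@profile R n A) = profile_grad A i &
      forall i j, partial i (partial j (@profile R n A)) = profile_hess A i j].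
Proof.
have P1 i : partial i (@profile R n A) = profile_grad A i.
  by apply/funext => x; have := is_derive_profile A i x; case.
have P2 i j : partial i (partial j (@profile R n A)) = profile_hess A i j.
  by rewrite P1; apply/funext => x; have := is_derive_profile_grad A i j x; case.
have cq : continuous (fun x : 'rV[R]_n => decay (weighted_sq (chi A) x)).
  move=> x; apply: continuous_comp; first exact: continuous_weighted_sq.
  exact/continuous_decay/weighted_sq_ge0.
have cx i : continuous (fun x : 'rV[R]_n => x 0 i) by exact: coord_continuous.
have cc (a : R) : continuous (fun _ : 'rV[R]_n => a) by exact: cst_continuous.
(* Stated for explicit pointwise expressions, these rules apply directly to the closed formulas for
   the derivatives. *)
have cM (f g : 'rV[R]_n -> R) : continuous f -> continuous g ->
    continuous (fun x => f x * g x).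
  by move=> cf cg x; exact: (continuousM (cf x) (cg x)).
have cD (f g : 'rV[R]_n -> R) : continuous f -> continuous g ->
    continuous (fun x => f x + g x).
  by move=> cf cg x; exact: (continuousD (cf x) (cg x)).
have cN (f : 'rV[R]_n -> R) : continuous f -> continuous (fun x => - f x).
  by move=> cf x; exact: (continuousN (cf x)).
have cV (f : 'rV[R]_n -> R) : (forall x, f x != 0) -> continuous f ->
    continuous (fun x => (f x)^-1).
  by move=> f0 cf x; exact: (continuousV (f0 x) (cf x)).
have cv : continuous (fun x : 'rV[R]_n => (1 + weighted_sq (chi A) x)^-1).
  apply: (cV); last by apply: (cD) => //; exact: continuous_weighted_sq.
  by move=> x; apply: lt0r_neq0; have := weighted_sq_ge0 A x; lra.
have cu : continuous (@profile R n A).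
  move=> x; apply: (@continuous_comp _ _ _
    (fun y : 'rV[R]_n => weighted_sq (chi (~: A)) y + (2 - decay (weighted_sq (chi A) y)))
    Num.sqrt); last exact: sqrt_continuous.
  apply: (cD); first exact: continuous_weighted_sq.
  by apply: (cD) => //; exact: (cN).
have cui : continuous (fun x : 'rV[R]_n => (profile A x)^-1).
  by apply: (cV) => // x; exact/lt0r_neq0/profile_gt0.
have cw i : continuous (fun x : 'rV[R]_n => weight A x i).
  by apply: (cD _ _ (cc _)); apply: (cM _ _ (cc _)); apply: (cM) => //; exact: (cM).
have cg i : continuous (@profile_grad R n A i).
  by apply: (cM) => //; exact: (cM).
have ch i j : continuous (@profile_hess R n A i j).
  apply: (cM) => //; apply: (cD); last by apply: (cN); exact: (cM).
  apply: (cD); first exact: (cM).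
  apply: (cM); last exact: (cM).
  apply: (cM); last exact: (cM).
  apply: (cM _ _ (cc _)); rewrite /bend; apply: (cM); first exact: (cM).
  by under eq_fun => x do rewrite expr2; exact: (cM).
split=> //; split=> // [i|i j].
  split; last by rewrite P1.
  by move=> x; have := is_derive_profile A i x; case.
split; last by rewrite P2.
by rewrite P1 => x; have := is_derive_profile_grad A i j x; case.
Qed.

(** * Inequalities in one variable *)

Lemma slope_gt0 (R : realType) (s : R) : 0 <= s -> 0 < slope s.
Proof.
by move=> s0; rewrite /slope !mulr_gt0 ?invr_gt0 ?decay_gt0 //; lra.
Qed.

(** Both [slope s] and [slope s * s] are at most 1/8, while the right side is at least 1. This is
    the spacelike condition, by [deficit_profile]. *)
Lemma slope_sqr_lt (R : realType) (s : R) : 0 <= s ->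
  slope s ^+ 2 * s < 2 - decay s.
Proof.
move=> s0; have v0 : 0 < 1 + s by lra.
have q1 := decay_le1 s0; have q0 := decay_gt0 s.
have a0 := slope_gt0 s0.
have av : slope s * (1 + s) = 8^-1 * decay s.
  by rewrite /slope mulfVK // lt0r_neq0.
have a1 : slope s <= 8^-1 by nra.
have as1 : slope s * s <= 8^-1 by nra.
have : slope s * (slope s * s) <= 8^-1 * 8^-1.
  by apply: ler_pM => //; [exact: ltW|rewrite mulr_ge0 // ltW].
rewrite expr2 mulrA; lra.
Qed.

(* The number [B]: the eigenvalue [slope s] of the diagonal part becomes
   [slope s + radial_defect s] in the direction of [y]. *)
Definition radial_defect {R : realType} (s : R) : R :=
  2 * bend s * s + slope s * (slope s - 1 + 2 * bend s * s) * (slope s * s)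
                   / (2 - decay s - slope s ^+ 2 * s).

(** The constant 5/2 is what $\mathcal H_2>0$ requires when [#|A|] is 5. As $s\to\infty$ the ratio
    [radial_defect s / slope s] tends to $-2(1+1/8)=-9/4$, so the exponent 1/8 leaves some room. *)
Lemma radial_defect_gt (R : realType) (s : R) : 0 <= s ->
  - (5 / 2 * slope s) < radial_defect s.
Proof.
move=> s0; have w0 := slope_sqr_lt s0.
have v0 : 1 + s != 0 by apply: lt0r_neq0; lra.
set w := 2 - decay s - slope s ^+ 2 * s.
have wpos : 0 < w by rewrite subr_gt0.
rewrite -subr_gt0 -(pmulr_lgt0 _ wpos).
(* Clearing the denominator [w] makes the products of [bend s] with [slope s ^+ 2] cancel. *)
have -> : (radial_defect s - - (5 / 2 * slope s)) * w =
  (5 / 2 * slope s + 2 * bend s * s) * (2 - decay s)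
    - slope s ^+ 2 * s - 3 / 2 * slope s ^+ 3 * s.
  have w1 := lt0r_neq0 wpos.
  by rewrite /radial_defect -/w mulrBl mulrDl mulfVK // /w; field.
have q0 := decay_gt0 s; have q1 := decay_le1 s0.
set q := decay s in q0 q1 *.
have -> : (5 / 2 * slope s + 2 * bend s * s) * (2 - q)
    - slope s ^+ 2 * s - 3 / 2 * slope s ^+ 3 * s =
  q / (1024 * (1 + s) ^+ 3) *
   (16 * (1 + s) * ((2 - q) * (2 * s + 20) - s * q) - 3 * s * q ^+ 2).
  by rewrite /slope /bend -/q; field.
have v3 : 0 < (1 + s) ^+ 3 by apply: exprn_gt0; lra.
apply: mulr_gt0; first by apply: divr_gt0; [exact: q0|lra].
(* It remains to bound the last factor below by $16(1+s)(s+20)-3s$, which is positive; only $0<q\le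
   1$ is used about [q]. *)
have h0 : 0 <= s * (1 - q) by rewrite mulr_ge0 ?subr_ge0.
have h1 : s + 20 <= (2 - q) * (2 * s + 20) - s * q by lra.
have h2 : s * q ^+ 2 <= s.
  apply: ler_piMr => //; rewrite expr_le1 //; exact: ltW.
have h3 : (1 + s) * (s + 20) <= (1 + s) * ((2 - q) * (2 * s + 20) - s * q).
  by rewrite ler_wpM2l //; lra.
have h4 : 0 <= s * s by rewrite mulr_ge0.
lra.
Qed.

(** * Gradient length and shape operator of the graph *)

Lemma chiC (R : realType) (n : nat) (A : {set 'I_n}) (i : 'I_n) :
  chi (~: A) i = 1 - chi A i :> R.
Proof. by rewrite /chi finset.in_setC; case: (_ \in _); rewrite ?subrr ?subr0. Qed.

Lemma chi_cases (R : realType) (n : nat) (A : {set 'I_n}) (i : 'I_n) :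
  chi A i = 1 :> R \/ chi A i = 0 :> R.
Proof. by rewrite /chi; case: (_ \in _); [left|right]. Qed.

Lemma sqr_profile (R : realType) (n : nat) (A : {set 'I_n}) (x : 'rV[R]_n) :
  profile A x ^+ 2 = weighted_sq (chi (~: A)) x + (2 - decay (weighted_sq (chi A) x)).
Proof. by rewrite sqr_sqrtr // ltW // radicand_gt0. Qed.

Lemma norm_grad_sqr (R : realType) (n : nat) (u : 'rV[R]_n -> R) (x : 'rV[R]_n) :
  norm_grad u x ^+ 2 = \sum_i partial i u x ^+ 2.
Proof. by apply: sqr_sqrtr; apply: sumr_ge0 => i _; exact: sqr_ge0. Qed.

Lemma sqr_norm_grad_profile (R : realType) (n : nat) (A : {set 'I_n}) (x : 'rV[R]_n) :
  norm_grad (profile A) x ^+ 2 =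
  (weighted_sq (chi (~: A)) x + slope (weighted_sq (chi A) x) ^+ 2 * weighted_sq (chi A) x)
  / profile A x ^+ 2.
Proof.
have [_ P1 _] := profile_C2 R A.
rewrite norm_grad_sqr.
rewrite mulr_sumr -big_split mulr_suml /=; apply: eq_bigr => i _.
rewrite P1 /profile_grad /weight !chiC; have := lt0r_neq0 (profile_gt0 A x).
by move=> u0; have [->|->] := chi_cases R A i; field.
Qed.

(** The squares of the coordinates outside [A] occur equally in $u^2$ and in $u^2|Du|^2$, so they
    cancel in the numerator. *)
Lemma deficit_profile (R : realType) (n : nat) (A : {set 'I_n}) (x : 'rV[R]_n) :
  1 - norm_grad (profile A) x ^+ 2 =
  (2 - decay (weighted_sq (chi A) x)
   - slope (weighted_sq (chi A) x) ^+ 2 * weighted_sq (chi A) x)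
  / profile A x ^+ 2.
Proof.
have u0 : profile A x ^+ 2 != 0 by rewrite expf_neq0 // lt0r_neq0 ?profile_gt0.
rewrite sqr_norm_grad_profile; apply: (mulIf u0).
by rewrite mulrBl !mulfVK // mul1r sqr_profile; ring.
Qed.

Lemma deficit_profile_gt0 (R : realType) (n : nat) (A : {set 'I_n}) (x : 'rV[R]_n) :
  0 < 1 - norm_grad (profile A) x ^+ 2.
Proof.
rewrite deficit_profile divr_gt0 ?exprn_gt0 ?profile_gt0 // subr_gt0.
exact/slope_sqr_lt/weighted_sq_ge0.
Qed.

Lemma spacelike_profile (R : realType) (n : nat) (A : {set 'I_n}) :
  spacelike (@profile R n A).
Proof.
have [C2u _ _] := profile_C2 R A; split=> // x.
have := deficit_profile_gt0 A x; rewrite subr_gt0.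
by rewrite expr_lt1 // sqrtr_ge0.
Qed.

(** The product $y\cdot Du$ enters both $D^2u\,Du$ and the trace of the rank one part of the shape
    operator. *)
Lemma grad_chi (R : realType) (n : nat) (A : {set 'I_n}) (x : 'rV[R]_n) :
  \sum_k (chi A k * x 0 k) * profile_grad A k x =
  slope (weighted_sq (chi A) x) * weighted_sq (chi A) x / profile A x.
Proof.
rewrite mulr_sumr mulr_suml /=; apply: eq_bigr => i _.
rewrite /profile_grad /weight chiC.
by have [->|->] := chi_cases R A i; ring.
Qed.

Lemma grad_hess (R : realType) (n : nat) (A : {set 'I_n}) (j : 'I_n) (x : 'rV[R]_n) :
  let s := weighted_sq (chi A) x in let u := profile A x in
  \sum_k profile_grad A k x * profile_hess A k j x =
  (weight A x j * profile_grad A j x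
   + 2 * bend s * (slope s * s / u) * (chi A j * x 0 j)
   - norm_grad (profile A) x ^+ 2 * profile_grad A j x) / u.
Proof.
move=> s u; have [_ P1 _] := profile_C2 R A.
rewrite norm_grad_sqr.
have -> : weight A x j * profile_grad A j x =
    \sum_k (k == j)%:R * (weight A x k * profile_grad A k x).
  rewrite (bigD1 j) //= eqxx mul1r big1 ?addr0 // => i /negPf ->.
  by rewrite mul0r.
rewrite -grad_chi mulr_sumr !mulr_suml -sumrN -!big_split /= mulr_suml.
by apply: eq_bigr => k _; rewrite P1 /profile_hess -/s -/u; ring.
Qed.

(** Since $|Du|^2=1-w$, the product $(I+Du\,Du^T/w)(E-Du\,Du^T)$ equals $E+Du\,(E\,Du-Du)^T/w$. The
    vector $E\,Du-Du$ vanishes outside [A], where the weight is 1, and is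
    [slope s * (slope s - 1 + 2 * bend s * s)] times $y/u$. *)
Lemma shape_operator_profile (R : realType) (n : nat) (A : {set 'I_n}) (x : 'rV[R]_n) :
  let s := weighted_sq (chi A) x in
  let w := 1 - norm_grad (profile A) x ^+ 2 in
  let rho := (Num.sqrt w * profile A x)^-1 in
  shape_operator (profile A) x =
  diag_mx (\row_i (rho * weight A x i)) +
  (\col_i (rho * (2 * bend s * (chi A i * x 0 i) +
    profile_grad A i x / (w * profile A x)
    * (slope s * (slope s - 1 + 2 * bend s * s))))) *m
  (\row_j (chi A j * x 0 j)).
Proof.
move=> s w rho; have [_ P1 P2] := profile_C2 R A.
have w0 : w != 0 by apply: lt0r_neq0; exact: deficit_profile_gt0.
have r0 : Num.sqrt w != 0.
  by apply: lt0r_neq0; rewrite sqrtr_gt0; exact: deficit_profile_gt0.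
have u0 := lt0r_neq0 (profile_gt0 A x).
apply/matrixP => i j; rewrite !mxE big_ord1 !mxE -/w.
have -> : \sum_k ((i == k)%:R + partial i (profile A) x * partial k (profile A) x / w) *
      partial k (partial j (profile A)) x =
   profile_hess A i j x + profile_grad A i x / w *
     \sum_k profile_grad A k x * profile_hess A k j x.
  have -> : profile_hess A i j x = \sum_k (i == k)%:R * profile_hess A k j x.
    rewrite (bigD1 i) //= eqxx mul1r big1 ?addr0 // => k.
    by rewrite eq_sym => /negPf ->; rewrite mul0r.
  rewrite mulr_sumr -big_split /=; apply: eq_bigr => k _.
  by rewrite !P2 !P1; ring.
rewrite grad_hess {1}/profile_hess -/s.
have -> : norm_grad (profile A) x ^+ 2 = 1 - w by rewrite /w opprB addrC subrK.
have -> : (rho * weight A x i) *+ (i == j) = (i == j)%:R * (rho * weight A x i).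
  by rewrite mulr_natl.
have -> : profile_grad A j x = weight A x j * x 0 j / profile A x by [].
have -> : weight A x j = 1 - chi A j + chi A j * slope s by rewrite /weight chiC.
(* The value of [w] is forgotten, so that [field] treats it as an atom. *)
rewrite /rho; move: w w0 r0 {rho} => w w0 r0.
by have [->|->] := chi_cases R A j; field; rewrite ?w0 ?r0 ?u0.
Qed.

(** * Principal curvatures and their power sums *)

(** The vector $y$ is supported in [A], where all weights equal [slope s], so [char_poly_diag_rank1]
    applies; any index of [A] may carry the exceptional eigenvalue. *)
Lemma principal_curvatures_profile (R : realType) (n : nat) (A : {set 'I_n})
    (x : 'rV[R]_n) (i0 : 'I_n) : i0 \in A ->
  let s := weighted_sq (chi A) x in
  exists2 rho : R, 0 < rho &
  char_poly (shape_operator (profile A) x) =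
  \prod_i ('X - (rho * (if i == i0 then slope s + radial_defect s
                        else weight A x i))%:P).
Proof.
move=> Ai0 s; have w0 := deficit_profile_gt0 A x.
have u0 := profile_gt0 A x.
exists (Num.sqrt (1 - norm_grad (profile A) x ^+ 2) * profile A x)^-1.
  by rewrite invr_gt0 mulr_gt0 // sqrtr_gt0.
rewrite shape_operator_profile; set rho := (_ * _)^-1; set z := \col_i _.
set d := \row_i (_ * _); set y := \row_j _.
have d0 : d 0 i0 = rho * slope s.
  by rewrite mxE /weight chiC /chi Ai0 subrr add0r mul1r.
(* This trace is the origin of [radial_defect]: the powers of $u$ from $y\cdot Du$ and from
   $1-|Du|^2$ cancel. *)
have yz : (y *m z) 0 0 = rho * radial_defect s.
  rewrite mxE.
  have -> : \sum_j y 0 j * z j 0 = \sum_j (rho * (2 * bend s) * (chi A j * x 0 j ^+ 2)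
     + rho * (slope s * (slope s - 1 + 2 * bend s * s)) /
       ((1 - norm_grad (profile A) x ^+ 2) * profile A x)
       * (chi A j * x 0 j * profile_grad A j x)).
    apply: eq_bigr => j _; rewrite !mxE -/s.
    by have [->|->] := chi_cases R A j; ring.
  rewrite big_split -!mulr_sumr /= grad_chi deficit_profile -/s.
  rewrite -[\sum_i _]/s /radial_defect.
  have w1 := lt0r_neq0 (w0); rewrite deficit_profile in w1.
  have := lt0r_neq0 u0.
  have : 2 - decay s - slope s ^+ 2 * s != 0.
    by apply: lt0r_neq0; rewrite subr_gt0 slope_sqr_lt // weighted_sq_ge0.
  move=> w2 u1; field.
  by rewrite w2 u1.
rewrite (@char_poly_diag_rank1 _ _ _ _ _ i0) => [|i].
  apply: eq_bigr => i _; rewrite yz d0; case: eqP => _; first by rewrite -mulrDr.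
  by rewrite mxE.
rewrite d0 !mxE /weight chiC; have [->|->] := chi_cases R A i; last by rewrite !mul0r.
by rewrite subrr add0r !mul1r subrr mulr0.
Qed.

Lemma sum_weight (R : realType) (n : nat) (A : {set 'I_n}) (x : 'rV[R]_n) :
  \sum_i weight A x i = #|~: A|%:R + #|A|%:R * slope (weighted_sq (chi A) x).
Proof.
rewrite big_split -mulr_suml /=.
by rewrite /chi -!natr_sum -!big_mkcond !sum1_card.
Qed.

Lemma sum_sqr_weight (R : realType) (n : nat) (A : {set 'I_n}) (x : 'rV[R]_n) :
  \sum_i weight A x i ^+ 2 = #|~: A|%:R + #|A|%:R * slope (weighted_sq (chi A) x) ^+ 2.
Proof.
transitivity (\sum_i (chi (~: A) i + chi A i * slope (weighted_sq (chi A) x) ^+ 2)).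
  apply: eq_bigr => i _; rewrite /weight chiC.
  by have [->|->] := chi_cases R A i; ring.
rewrite big_split -mulr_suml /=.
by rewrite /chi -!natr_sum -!big_mkcond !sum1_card.
Qed.

Lemma curvature_sums_profile (R : realType) (n : nat) (A : {set 'I_n})
    (x : 'rV[R]_n) : (0 < #|A|)%N ->
  let s := weighted_sq (chi A) x in
  exists (rho : R) (l : 'rV[R]_n),
  [/\ 0 < rho,
      char_poly (shape_operator (profile A) x) = \prod_i ('X - (l 0 i)%:P),
      \sum_i l 0 i =
        rho * (#|~: A|%:R + #|A|%:R * slope s + radial_defect s) &
      \sum_i l 0 i ^+ 2 =
        rho ^+ 2 * (#|~: A|%:R + (#|A|%:R - 1) * slope s ^+ 2
                    + (slope s + radial_defect s) ^+ 2)].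
Proof.
rewrite card_gt0 => /set0Pn[i0 Ai0] s.
have [rho rho0 charE] := principal_curvatures_profile x Ai0.
pose f i := if i == i0 then slope s + radial_defect s else weight A x i.
exists rho, (\row_i (rho * f i)); split=> //.
- by rewrite charE; apply: eq_bigr => i _; rewrite mxE.
- under eq_bigr do rewrite mxE.
  rewrite -mulr_sumr -sum_weight; congr (_ * _).
  rewrite (bigD1 i0) //= [in RHS](bigD1 i0) //= {1}/f eqxx {1}/weight chiC.
  rewrite /chi Ai0 subrr add0r mul1r -/s [in RHS]addrAC; congr (_ + _).
  by apply: eq_bigr => i /negPf; rewrite /f => ->.
- under eq_bigr do rewrite mxE exprMn.
  rewrite -mulr_sumr; congr (_ * _).
  rewrite mulrBl mul1r addrA -sum_sqr_weight.
  rewrite (bigD1 i0) //= [in RHS](bigD1 i0) //= {1}/f eqxx {1}/weight chiC.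
  rewrite /chi Ai0 subrr add0r mul1r -/s addrC; congr (_ + _).
  rewrite addrAC subrr add0r.
  by apply: eq_bigr => i /negPf; rewrite /f => ->.
Qed.

(** * Positivity of the mean curvatures *)

(** Up to the factor [rho], the sum of the curvatures is at least [3 * slope s + radial_defect s],
    and 3 exceeds 5/2. *)
Lemma mean_curvature1_profile (R : realType) (n : nat) (A : {set 'I_n})
    (x : 'rV[R]_n) : (3 <= #|A|)%N -> 0 < mean_curvature 1 (profile A) x.
Proof.
move=> A3.
have [rho [l [rho0 charE sumE _]]] :=
  curvature_sums_profile x (ltn_trans (isT : 0 < 2)%N A3).
apply: (mean_curvature_gt0 charE); rewrite sigma1E sumE.
move: sumE; set s := weighted_sq _ x => sumE; apply: mulr_gt0 => //.
have s0 : 0 <= s := weighted_sq_ge0 A x.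
have B0 := radial_defect_gt s0; have a0 := slope_gt0 s0.
have e0 : 0 <= #|~: A|%:R :> R by rewrite ler0n.
have M3 : 3 <= #|A|%:R :> R by rewrite ler_nat.
have : 3 * slope s <= #|A|%:R * slope s by rewrite ler_wpM2r // ltW.
lra.
Qed.

Lemma mean_curvature2_profile (R : realType) (n : nat) (A : {set 'I_n})
    (x : 'rV[R]_n) : (5 <= #|A|)%N -> 0 < mean_curvature 2 (profile A) x.
Proof.
move=> A5.
have [rho [l [rho0 charE sumE sum2E]]] :=
  curvature_sums_profile x (ltn_trans (isT : 0 < 4)%N A5).
apply: (mean_curvature_gt0 charE).
have two0 : 0 < 2 :> R by lra.
rewrite -(pmulr_rgt0 _ two0) sigma2E sumE sum2E.
move: sumE sum2E; set s := weighted_sq _ x => _ _.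
have s0 : 0 <= s := weighted_sq_ge0 A x.
rewrite exprMn -mulrBr; apply: mulr_gt0; first exact: exprn_gt0.
have B0 := radial_defect_gt s0; have a0 := slope_gt0 s0.
have e0 : 0 <= #|~: A|%:R :> R by rewrite ler0n.
(* This holds because the cardinal is a natural number. *)
have e1 : #|~: A|%:R <= #|~: A|%:R ^+ 2 :> R.
  by rewrite -natrX ler_nat; case: #|_| => // k; rewrite expnS leq_pmulr // expn_gt0.
have M5 : 5 <= #|A|%:R :> R by rewrite ler_nat.
move: (radial_defect s) (slope s) (#|A|%:R : R) (#|~: A|%:R : R) B0 a0 M5 e0 e1.
move=> B a M e B0 a0 M5 e0 e1.
have MaB : 0 < M * a + B.
  have : 5 * a <= M * a by rewrite ler_wpM2r // ltW.
  lra.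
(* Twice $\sigma_2$ is regrouped into nonnegative terms; the third is strictly positive by the bound
   on [B], and the fourth needs $M\ge 5$. *)
have -> : (e + M * a + B) ^+ 2 - (e + (M - 1) * a ^+ 2 + (a + B) ^+ 2) =
  (e ^+ 2 - e) + 2 * (e * (M * a + B)) + 2 * ((M - 1) * (a * (B + 5 / 2 * a)))
   + (M - 5) * ((M - 1) * a ^+ 2) by field.
have M1 : 0 < M - 1 by lra.
have h1 : 0 <= e * (M * a + B) by rewrite mulr_ge0 // ltW.
have h2 : 0 < (M - 1) * (a * (B + 5 / 2 * a)).
  by rewrite !mulr_gt0 //; lra.
have h3 : 0 <= (M - 5) * ((M - 1) * a ^+ 2).
  by rewrite mulr_ge0 ?subr_ge0 // mulr_ge0 ?sqr_ge0 // ltW.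
lra.
Qed.

Lemma admissible_profile (R : realType) (n : nat) (A : {set 'I_n}) :
  (5 <= #|A|)%N -> admissible (@profile R n A).
Proof.
move=> A5; split=> [|x|x]; first exact: spacelike_profile.
  by apply: mean_curvature1_profile; apply: leq_trans A5.
exact: mean_curvature2_profile.
Qed.

(** * Bounds on the graph function, and the three existence statements *)

Lemma profile_le (R : realType) (n : nat) (A : {set 'I_n}) (x : 'rV[R]_n) :
  profile A x <= Num.sqrt (weighted_sq (chi (~: A)) x + 2).
Proof.
apply: ler_wsqrtr; rewrite lerD2l.
by have := decay_gt0 (weighted_sq (chi A) x); lra.
Qed.

Lemma profile_ge (R : realType) (n : nat) (A : {set 'I_n}) (x : 'rV[R]_n) :
  Num.sqrt (weighted_sq (chi (~: A)) x) <= profile A x.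
Proof.
apply: ler_wsqrtr; rewrite lerDl.
by have := decay_le1 (weighted_sq_ge0 A x); lra.
Qed.

Lemma profile_setT_le (R : realType) (n : nat) (x : 'rV[R]_n) :
  profile [set: 'I_n] x <= Num.sqrt 2.
Proof.
have -> : 2 = weighted_sq (chi (~: [set: 'I_n])) x + 2 :> R; last exact: profile_le.
rewrite /weighted_sq big1 ?add0r // => i _.
by rewrite chiC /chi finset.in_setT subrr mul0r.
Qed.

Theorem proposition6p3 (R : realType) :
  [/\ forall n : nat, (3 <= n)%N ->
        exists u : 'rV[R]_n -> R,
          [/\ spacelike u,
              forall x, 0 < mean_curvature 1 u x &
              (ereal_sup (range (fun x => (u x)%:E)) < +oo)%E],
      forall n : nat, (5 <= n)%N ->
        exists u : 'rV[R]_n -> R, admissible u /\ bounded_fun u &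
      forall n : nat, (6 <= n.+1)%N ->
        exists (c : R) (u : 'rV[R]_n.+1 -> R),
          [/\ 0 < c, admissible u &
              forall x : 'rV[R]_n.+1,
                `|x ord0 ord0| <= u x <= Num.sqrt (x ord0 ord0 ^+ 2 + c)]].
Proof.
split=> n n_ge.
- exists (profile [set: 'I_n]); split=> [|x|]; first exact: spacelike_profile.
    by apply: mean_curvature1_profile; rewrite cardsT card_ord.
  apply: (@le_lt_trans _ _ (Num.sqrt 2)%:E); last exact: ltry.
  apply: ge_ereal_sup => _ [x _ <-].
  by rewrite lee_fin profile_setT_le.
- exists (profile [set: 'I_n]); split.
    by apply: admissible_profile; rewrite cardsT card_ord.
  exists (Num.sqrt 2); split=> [|M M2]; first exact: num_real.
  move=> x _ /=; rewrite gtr0_norm ?profile_gt0 //.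
  exact: le_trans (profile_setT_le x) (ltW M2).
(* The dimension is [n.+1], so [A] has [n] elements, at least 5. The constant 2 chosen below for [c]
   bounds [2 - decay s] from above. *)
- pose A : {set 'I_n.+1} := ~: finset.set1 ord0.
  have A0 (x : 'rV[R]_n.+1) : weighted_sq (chi (~: A)) x = x ord0 ord0 ^+ 2.
    rewrite /weighted_sq (bigD1 ord0) //= big1 => [|i i0].
      by rewrite addr0 /chi finset.setCK set11 mul1r.
    by rewrite /chi finset.setCK finset.in_set1 (negPf i0) mul0r.
  exists 2, (profile A); split=> [||x]; first by lra.
    by apply: admissible_profile; rewrite cardsC1 card_ord.
  by rewrite -A0 profile_le andbT -sqrtr_sqr -A0 profile_ge.
Qed.
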